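(* Let $(\mathcal{A}, \|\cdot\|)$ be a Banach algebra and $\mathcal{B}$ be a closed subalgebra of $\mathcal{A}$. Then $N(\mathcal{A})$ and $N(\mathcal{B})$ are both singletons if and only if $N(\mathcal{A} \times_d \mathcal{B})$ is a singleton.
   Context: Algebras are associative algebras over $\mathbb{C}$ (not assumed unital or commutative). An algebra norm on an algebra $\mathcal{A}$ is a vector space norm $\|\cdot\|$ on $\mathcal{A}$ that is submultiplicative, i.e. $\|ab\| \le \|a\|\|b\|$ for all $a,b \in \mathcal{A}$ (completeness is not required). A Banach algebra is an algebra with a complete algebra norm. $N(\mathcal{A})$ denotes the set of equivalence classes of all algebra norms on $\mathcal{A}$, where two norms are identified if they are equivalent (induce the same topology). For an algebra $\mathcal{A}$ and a subalgebra $\mathcal{B}$ of $\mathcal{A}$, the direct-sum product algebra $\mathcal{A} \times_d \mathcal{B}$ is the vector space $\mathcal{A} \times \mathcal{B}$ with coordinatewise linear operations and the product $(a,b) \times_d (c,d) = (ac + ad + bc, bd)$. *)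

(* Defs.v *)
From HB Require Import structures.
From mathcomp Require Import all_boot all_order all_algebra.
From mathcomp Require Import all_classical all_reals all_analysis.
From mathcomp.real_closed Require Import complex.

Set Implicit Arguments.
Unset Strict Implicit.
Unset Printing Implicit Defensive.

Import Order.TTheory GRing.Theory Num.Theory.
Import numFieldNormedType.Exports.

Local Open Scope classical_set_scope.
Local Open Scope ring_scope.

(* MathComp's algType is unital, so the multiplication of an associative
   algebra that need not have a unit is a separate operation, amul. *)
HB.mixin Record Lmodule_isNuAlgebra (K : nzRingType) A of GRing.Lmodule K A := {
  amul : A -> A -> A;
  amulA : associative amul;
  amul_bilinear : bilinear_for *:%R *:%R amul
}.

#[short(type="nuAlgType")]
HB.structure Definition NuAlgebra (K : nzRingType) :=
  {A of Lmodule_isNuAlgebra K A & GRing.Lmodule K A}.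

Section NuAlgebraTheory.
Context {K : nzRingType} {A : nuAlgType K}.
Implicit Types (a b c : A) (k : K).

Lemma amulDl a b c : amul (a + b) c = amul a c + amul b c.
Proof. by have /= := amul_bilinear.1 c 1 a b; rewrite !scale1r. Qed.

Lemma amulDr a b c : amul a (b + c) = amul a b + amul a c.
Proof. by have /= := amul_bilinear.2 a 1 b c; rewrite !scale1r. Qed.

Lemma amul0l a : amul 0 a = 0.
Proof. by apply: (addrI (amul 0 a)); rewrite -amulDl !addr0. Qed.

Lemma amul0r a : amul a 0 = 0.
Proof. by apply: (addrI (amul a 0)); rewrite -amulDr !addr0. Qed.

Lemma amulZl k a b : amul (k *: a) b = k *: amul a b.
Proof. by have /= := amul_bilinear.1 b k a 0; rewrite amul0l !addr0. Qed.

Lemma amulZr k a b : amul a (k *: b) = k *: amul a b.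
Proof. by have /= := amul_bilinear.2 a k b 0; rewrite amul0r !addr0. Qed.

End NuAlgebraTheory.

HB.mixin Record NuAlgebra_isBanach (K : numFieldType) A
    of NuAlgebra K A & CompleteNormedModule K A := {
  ler_amul_norm : forall a b : A, `|amul a b| <= `|a| * `|b|
}.

#[short(type="banachAlgType")]
HB.structure Definition BanachAlgebra (K : numFieldType) :=
  {A of NuAlgebra K A & CompleteNormedModule K A & NuAlgebra_isBanach K A}.

HB.mixin Record isAmulClosed (K : nzRingType) (A : nuAlgType K)
    (S : {pred A}) := {
  rpred_amul : {in S &, forall a b, amul a b \in S}
}.

#[short(type="nuSubalgClosed")]
HB.structure Definition NuSubalgClosed (K : nzRingType) (A : nuAlgType K) :=
  {S of isAmulClosed K A S & @GRing.SubmodClosed K A S}.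

Section Subalgebra.
Context {K : nzRingType} {A : nuAlgType K} (B : nuSubalgClosed A).

Definition subalg : Type := {x : A | x \in B}.

HB.instance Definition _ := SubChoice.on subalg.
HB.instance Definition _ := [SubChoice_isSubLmodule of subalg by <:].

Definition subalg_mul (x y : subalg) : subalg :=
  exist _ (amul (val x) (val y)) (rpred_amul _ _ (valP x) (valP y)).

Fact subalg_mulA : associative subalg_mul.
Proof. by move=> x y z; apply: val_inj; rewrite /= amulA. Qed.

Fact subalg_mul_bilinear : bilinear_for *:%R *:%R subalg_mul.
Proof.
by split=> w k u v; apply: val_inj;
  rewrite /= ?(amulDl, amulDr) ?(amulZl, amulZr).
Qed.

HB.instance Definition _ :=
  Lmodule_isNuAlgebra.Build K subalg subalg_mulA subalg_mul_bilinear.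

(* The algebra A x_d B. *)
Definition dsprod : Type := (A * subalg)%type.

HB.instance Definition _ := GRing.Lmodule.on dsprod.

Definition dsprod_mul (u v : dsprod) : dsprod :=
  (amul u.1 v.1 + amul u.1 (val v.2) + amul (val u.2) v.1, amul u.2 v.2).

Fact dsprod_mulA : associative dsprod_mul.
Proof.
move=> [a b] [c d] [e f]; rewrite /dsprod_mul /=; congr (_, _).
  rewrite !(amulDl, amulDr) !amulA !addrA.
  by rewrite [LHS](ACl (1*3*5*2*4*6*7))%AC.
exact: amulA.
Qed.

Fact dsprod_mul_bilinear : bilinear_for *:%R *:%R dsprod_mul.
Proof.
split=> -[c d] k [a b] [a' b']; rewrite /dsprod_mul /=; congr (_, _).
all: rewrite ?(amulDl, amulDr) ?(amulZl, amulZr) //.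
all: by rewrite /= !scalerDr !addrA [LHS](ACl (1*3*5*2*4*6))%AC.
Qed.

HB.instance Definition _ :=
  Lmodule_isNuAlgebra.Build K dsprod dsprod_mulA dsprod_mul_bilinear.

End Subalgebra.

(* As for Num.norm, norms take their values in the scalar field K; the axioms
   force these values to be nonnegative, hence real when K = R[i]. *)
Record algNorm (K : numFieldType) (A : nuAlgType K) := AlgNorm {
  alg_norm :> A -> K;
  alg_normD : forall x y, alg_norm (x + y) <= alg_norm x + alg_norm y;
  alg_normZ : forall (l : K) x, alg_norm (l *: x) = `|l| * alg_norm x;
  alg_norm0_eq0 : forall x, alg_norm x = 0 -> x = 0;
  alg_normM : forall x y, alg_norm (amul x y) <= alg_norm x * alg_norm y
}.

Section NormClasses.
Context {K : numFieldType} {A : nuAlgType K}.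

(* A copy of A carrying the normed space structure, and thus the topology,
   defined by p. *)
Definition normed_by (p : algNorm A) : Type := A.

HB.instance Definition _ (p : algNorm A) := GRing.Lmodule.on (normed_by p).
HB.instance Definition _ (p : algNorm A) :=
  @Lmodule_isNormed.Build K (normed_by p) p
    (alg_normD p) (alg_normZ p) (@alg_norm0_eq0 K A p).

Definition norm_topology (p : algNorm A) : set (set A) :=
  @open (normed_by p).

Definition norm_equiv (p q : algNorm A) : Prop :=
  norm_topology p = norm_topology q.

Definition norm_class (p : algNorm A) : set (algNorm A) :=
  [set q | norm_equiv p q].

End NormClasses.

(* The set N(A). *)
Definition norm_classes {K : numFieldType} (A : nuAlgType K) :
    set (set (algNorm A)) :=
  range (@norm_class K A).
Arguments norm_classes {K} A.

Definition singleton {T : Type} (S : set T) : Prop := exists x, S = [set x].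

(* Main.v *)
(** The map (a, b) |-> (a + b, b) is an isomorphism of A x_d B onto the
    direct product of A and B with the coordinatewise multiplication, so A and
    B are retracts of A x_d B and, at the same time, complementary ideals of it.

    If all norms on the product are equivalent, then two norms on a factor are
    compared by adding to each of them a fixed norm of the other factor.

    Conversely, let p be a norm on the product, and suppose that all norms on
    each factor are equivalent. Each factor is then complete for the
    restriction of p, hence p-closed, so that p induces a quotient norm on the
    other factor. Being equivalent to the given norm, this quotient norm bounds
    the projections, whence p is equivalent to the sum of the two norms. *)

From HB Require Import structures.
Require Import Defs.
From mathcomp Require Import all_boot all_order all_algebra.
From mathcomp Require Import all_classical all_reals all_analysis.
From mathcomp.real_closed Require Import complex.

Set Implicit Arguments.
Unset Strict Implicit.
Unset Printing Implicit Defensive.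

Import Order.TTheory GRing.Theory Num.Theory.
Import numFieldNormedType.Exports.
Local Open Scope classical_set_scope.
Local Open Scope ring_scope.

Section AmulTheory.
Context {K : nzRingType} {A : nuAlgType K}.
Implicit Types (x y : A).

Lemma amulNl x y : amul (- x) y = - amul x y.
Proof. by rewrite -scaleN1r amulZl scaleN1r. Qed.

Lemma amulNr x y : amul x (- y) = - amul x y.
Proof. by rewrite -scaleN1r amulZr scaleN1r. Qed.

End AmulTheory.

(** * Equivalence of algebra norms as domination in both directions *)

Section AlgNormTheory.
Context {K : numFieldType} {A : nuAlgType K}.
Implicit Types (p q : algNorm A) (x y : A).

Lemma alg_norm_ge0 p x : 0 <= p x.
Proof. exact: (@normr_ge0 _ (normed_by p) x). Qed.

Lemma alg_norm0 p : p 0 = 0.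
Proof. exact: (@normr0 _ (normed_by p)). Qed.

Lemma alg_normB p x y : p (x - y) <= p x + p y.
Proof. exact: (@ler_normB _ (normed_by p) x y). Qed.

(** The open unit ball of [p] is also open for [q], so it contains a [q]-ball about 0, into which
    every vector can be scaled. *)
Lemma norm_topology_le p q :
  norm_topology p = norm_topology q ->
  exists2 M, 0 < M & forall x, p x <= M * q x.
Proof.
move=> pq.
have : norm_topology p (@ball _ (normed_by p) 0 1) by exact: ball_open.
rewrite pq /norm_topology openE => /(_ 0 (ballxx _ ltr01)) /nbhs_ballP.
case=> r /= r0 rsub; exists (2 / r) => [|x]; first by rewrite divr_gt0.
have [->|x0] := eqVneq x 0; first by rewrite !alg_norm0 mulr0.
have qx0 : 0 < q x.
  rewrite lt_def alg_norm_ge0 andbT.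
  by apply: contra_neq x0; exact: alg_norm0_eq0.
(* This scalar gives [q (l *: x) = r / 2 < r], and [p (l *: x) < 1] then yields the bound with
   constant [2 / r]. *)
pose l := r / (2 * q x).
have l0 : 0 < l by rewrite divr_gt0 // mulr_gt0.
have : (@ball _ (normed_by p) 0 1) (l *: x).
  apply: rsub; rewrite -ball_normE /= sub0r normrN.
  change (q (l *: x) < r).
  rewrite alg_normZ gtr0_norm // /l invfM mulrA divfK ?gt_eqF //.
  by rewrite ltr_pdivrMr // mulr_natr mulr2n ltrDl.
rewrite -ball_normE /= sub0r normrN.
change (p (l *: x) < 1 -> p x <= 2 / r * q x).
rewrite alg_normZ gtr0_norm // => /ltW.
by rewrite -ler_pdivlMl // mulr1 /l invf_div mulrAC.
Qed.

Lemma norm_topology_sub p q M :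
  0 < M -> (forall x, p x <= M * q x) -> norm_topology p `<=` norm_topology q.
Proof.
move=> M0 pq U; rewrite /norm_topology !openE => Uo x /Uo /nbhs_ballP[r /= r0].
rewrite -ball_normE => rsub.
apply/nbhs_ballP; exists (r / M); rewrite /= ?divr_gt0 //.
rewrite -ball_normE => y; change (q (x - y) < r / M -> U y) => xy.
apply: rsub; change (p (x - y) < r).
by apply: le_lt_trans (pq _) _; rewrite mulrC -ltr_pdivlMr.
Qed.

Lemma norm_equivP p q :
  norm_equiv p q <->
  (exists2 M, 0 < M & forall x, p x <= M * q x) /\
  (exists2 M, 0 < M & forall x, q x <= M * p x).
Proof.
split=> [pq|[[M M0 pq] [N N0 qp]]].
  by split; apply: norm_topology_le.
by apply/seteqP; split;
  [exact: norm_topology_sub M0 pq|exact: norm_topology_sub N0 qp].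
Qed.

(** The set of classes is empty when there is no algebra norm, so existence stands beside uniqueness
    up to equivalence. *)
Lemma singleton_norm_classesP :
  singleton (norm_classes A) <->
  inhabited (algNorm A) /\ forall p q, norm_equiv p q.
Proof.
split=> [[S AS]|[[p] all_equiv]].
  have class_eq p : norm_class p = S.
    by have : norm_classes A (norm_class p) by [exists p]; rewrite AS.
  have : norm_classes A S by rewrite AS.
  move=> [p _ _]; split=> // p1 p2.
  have : norm_class p2 p2 by rewrite /norm_class.
  by rewrite class_eq -(class_eq p1).
exists (norm_class p); apply/seteqP; split=> [_ [q _ <-]|_ ->]; last by exists p.
by apply/seteqP; split=> r _; apply: all_equiv.
Qed.

End AlgNormTheory.

(** * Pullbacks and sums of algebra norms *)

Section Constructions.
Local Obligation Tactic := idtac.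
Context {K : numFieldType}.

Definition amul_morph (A C : nuAlgType K) (f : A -> C) : Prop :=
  {morph f : x y / amul x y}.

Program Definition comp_norm (A C : nuAlgType K) (f : {linear A -> C})
    (fM : amul_morph f) (f_inj : injective f) (p : algNorm C) : algNorm A :=
  @AlgNorm K A (fun x => p (f x)) _ _ _ _.
Next Obligation. by move=> A C f fM f_inj p x y /=; rewrite linearD alg_normD. Qed.
Next Obligation. by move=> A C f fM f_inj p l x /=; rewrite linearZ alg_normZ. Qed.
Next Obligation.
by move=> A C f fM f_inj p x /= /alg_norm0_eq0; rewrite -(linear0 f) => /f_inj.
Qed.
Next Obligation. by move=> A C f fM f_inj p x y /=; rewrite fM alg_normM. Qed.

Program Definition sum_norm (A B C : nuAlgType K)
    (f : {linear C -> A}) (g : {linear C -> B})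
    (fM : amul_morph f) (gM : amul_morph g)
    (fg_inj : forall x, f x = 0 -> g x = 0 -> x = 0)
    (p : algNorm A) (q : algNorm B) : algNorm C :=
  @AlgNorm K C (fun x => p (f x) + q (g x)) _ _ _ _.
Next Obligation.
by move=> * /=; rewrite !linearD addrACA lerD ?alg_normD.
Qed.
Next Obligation. by move=> * /=; rewrite !linearZ !alg_normZ mulrDr. Qed.
Next Obligation.
move=> A B C f g fM gM fg_inj p q x /= /eqP.
rewrite paddr_eq0 ?alg_norm_ge0 // => /andP[/eqP px /eqP qx].
by apply: fg_inj; apply: alg_norm0_eq0; [exact: px|exact: qx].
Qed.
Next Obligation.
move=> A B C f g fM gM fg_inj p q x y /=; rewrite fM gM.
apply: le_trans (lerD (alg_normM _ _ _) (alg_normM _ _ _)) _.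
by rewrite mulrDl !mulrDr lerD // ?lerDl ?lerDr mulr_ge0 ?alg_norm_ge0.
Qed.

End Constructions.

(** * Quotient norms *)

Section QuotientNorm.
Context {R : realType}.

(** The order of [R[i]] relates only numbers with equal imaginary parts. Elements of [S] are real,
    being nonnegative, and so is every lower bound; the infimum is that of the real parts. *)
Lemma complex_glb (S : set R[i]) :
  S !=set0 -> (forall z, S z -> 0 <= z) ->
  exists2 w, forall z, S z -> w <= z &
    forall y, (forall z, S z -> y <= z) -> y <= w.
Proof.
move=> [z0 Sz0] S_ge0.
have S_re z : S z -> z = (complex.Re z)%:C%C.
  by move=> /S_ge0 /ger0_real /RRe_real.
have re_ge0 z : S z -> 0 <= complex.Re z.
  by move=> Sz; rewrite -lecR -S_re // S_ge0.
have ge0 : has_lbound (@complex.Re R @` S).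
  by exists 0 => _ [z Sz <-]; apply: re_ge0.
exists (inf (@complex.Re R @` S))%:C%C => [z Sz|y ySz].
  by rewrite [z]S_re // lecR; apply: ge_inf => //; exists z.
have yE : y = (complex.Re y)%:C%C.
  have := ySz _ Sz0; rewrite [z0]S_re // lecE => /andP[/eqP /= y0 _].
  by case: y y0 {ySz} => a b /= <-.
rewrite yE lecR; apply: lb_le_inf => [|_ [z Sz <-]].
  by exists (complex.Re z0), z0.
by rewrite -lecR -yE -S_re // ySz.
Qed.

(** The norm at [d] is the infimum of [p] over the fibre of [f] above [d]. By [ker_closed], the
    kernel of [f] is closed for [p], which makes this seminorm definite. *)
Lemma quotient_norm (C D : nuAlgType R[i]) (f : {linear C -> D})
    (fM : amul_morph f) (f_surj : forall d, exists c, f c = d)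
    (p : algNorm C)
    (ker_closed : forall c,
      (forall e, 0 < e -> exists2 c', f c' = f c & p c' < e) -> f c = 0) :
  exists q : algNorm D, forall c, q (f c) <= p c.
Proof.
have /choice[q qP] d : exists w : R[i],
    (forall c, f c = d -> w <= p c) /\
    (forall y, (forall c, f c = d -> y <= p c) -> y <= w).
  have [||w w_lb w_glb] := @complex_glb [set p c | c in [set c | f c = d]].
  - by have [c fc] := f_surj d; exists (p c), c.
  - by move=> _ [c _ <-]; exact: alg_norm_ge0.
  exists w; split=> [c fc|y yle]; first by apply: w_lb; exists c.
  by apply: w_glb => _ [c fc <-]; exact: yle.
have q_le c : q (f c) <= p c by have [+ _] := qP (f c); exact.
have q_glb y d : (forall c, f c = d -> y <= p c) -> y <= q d.
  by have [_] := qP d; exact.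
have q_ge0 d : 0 <= q d by apply: q_glb => c _; exact: alg_norm_ge0.
have q_glbM k y d :
    0 <= k -> (forall c, f c = d -> y <= k * p c) -> y <= k * q d.
  rewrite le_eqVlt => /predU1P[<- yle|k0 yle].
    by have [c /yle] := f_surj d; rewrite !mul0r.
  by rewrite -ler_pdivrMl //; apply: q_glb => c /yle; rewrite ler_pdivrMl.
have qZ_le l d : q (l *: d) <= `|l| * q d.
  by apply: q_glbM => // c <-; rewrite -linearZ -alg_normZ q_le.
have q_add x y : q (x + y) <= q x + q y.
  (* The infimum is taken over the preimages of [x] first, then over those of [y]. *)
  rewrite -lerBlDr; apply: (q_glb) => c <-; rewrite lerBlDr [leRHS]addrC -lerBlDr.
  apply: q_glb => c' <-; rewrite lerBlDr [leRHS]addrC.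
  by rewrite -linearD; apply: le_trans (q_le _) (alg_normD _ _ _).
have q_scale l d : q (l *: d) = `|l| * q d.
  apply/eqP; rewrite eq_le qZ_le /=.
  have [->|l0] := eqVneq l 0; first by rewrite normr0 mul0r.
  (* The reverse inequality is [qZ_le] for the scalar [l^-1] and the vector [l *: d]. *)
  rewrite -ler_pdivlMl ?normr_gt0 // -normfV.
  by apply: le_trans (qZ_le _ _); rewrite scalerA mulVf // scale1r.
have q_eq0 d : q d = 0 -> d = 0.
  have [c <-] := f_surj d => qd; apply: ker_closed => e e0.
  apply/not_exists2P => noc; suff : e <= q (f c) by rewrite qd => /le_gtF; rewrite e0.
  apply: q_glb => c' fc'; have [//|] := noc c'.
  by move=> /negP; rewrite -real_leNgt // ger0_real // ?(ltW e0) ?alg_norm_ge0.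
have q_mul x y : q (amul x y) <= q x * q y.
  apply: (q_glbM) => // c <-; rewrite mulrC.
  apply: q_glbM => [|c' <-]; first exact: alg_norm_ge0.
  by rewrite -fM mulrC; apply: le_trans (q_le _) (alg_normM _ _ _).
by exists (AlgNorm q_add q_scale q_eq0 q_mul).
Qed.

End QuotientNorm.

(** * Complete norms and closed kernels *)

Section CompleteNorm.
Context {K : numFieldType}.

Definition complete_norm (I : nuAlgType K) (n : algNorm I) : Prop :=
  forall F : set_system I, ProperFilter F ->
    (forall e, 0 < e -> exists x, F [set y | n (x - y) < e]) ->
    exists l, forall e, 0 < e -> F [set y | n (l - y) < e].

(** The isometry [f] sends a Cauchy filter to a convergent one in [V], and closedness of the range
    gives the limit a preimage. *)
Lemma complete_norm_closed (I : nuAlgType K) (V : completeNormedModType K)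
    (n : algNorm I) (f : {linear I -> V}) :
  (forall x, n x = `|f x|) -> closed (range f) -> complete_norm n.
Proof.
move=> nE f_closed F FF F_cauchy.
have : cvg (f @ F).
  apply: cauchy_cvg; apply: cauchy_exP => e /F_cauchy[x Fx]; exists (f x).
  by rewrite /nbhs /= -ball_normE; apply: filterS Fx => y /=; rewrite nE linearB.
move=> /cvg_ex[v fv].
have [l _ lv] : range f v.
  apply: (closed_cvg (range f)) fv => //.
  by apply: nearW => x; exists x.
exists l => e e0; have /cvgrPdist_lt /(_ e e0) := fv.
by apply: filterS => y; rewrite -lv /= nE linearB.
Qed.

(* s d is a representative of the coset d; the limit of the Cauchy filter of
   all i with s d + u i close to 0 shows that d meets 0. *)
Lemma complete_ker_closed (I C D : nuAlgType K) (n : algNorm I) (p : algNorm C)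
    (u : {linear I -> C}) (r : {linear C -> I})
    (f : {linear C -> D}) (s : {linear D -> C}) (M N : K) :
  complete_norm n -> (forall i, f (u i) = 0) -> cancel s f ->
  (forall c, s (f c) + u (r c) = c) ->
  0 < M -> (forall i, n i <= M * p (u i)) ->
  0 < N -> (forall i, p (u i) <= N * n i) ->
  forall c, (forall e, 0 < e -> exists2 c', f c' = f c & p c' < e) -> f c = 0.
Proof.
move=> n_complete fu sf decomp M0 nM N0 pN c c_small; set d := f c.
pose near0 e := [set i | p (s d + u i) < e].
pose F := filter_from [set e | 0 < e] near0.
have near0_nonempty e : 0 < e -> near0 e !=set0.
  move=> /c_small[c' fc' pc']; exists (r c').
  by rewrite /near0 /= /d -fc' decomp.
have FF : ProperFilter F.
  apply: filter_from_proper near0_nonempty.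
  apply: filter_from_filter; first by exists 1; exact: ltr01.
  move=> a b a0 b0; exists (Num.min a b).
    by rewrite /= /Order.min; case: ifP.
  (* The order of [K] may be partial, but positive elements are real, hence comparable. *)
  have ab_cmp : (a >=< b)%O by apply: real_comparable; apply: gtr0_real.
  by move=> x; rewrite /near0 /= comparable_lt_min // => /andP[].
have [|l Fl] := n_complete F FF.
  (* Two points of [near0 (e / (2 * M))] have images under [u] at [p]-distance below [e / M], so
     their [n]-distance is below [e]. *)
  move=> e e0; have e'0 : 0 < e / (2 * M) by rewrite divr_gt0 // mulr_gt0.
  have [x xe] := near0_nonempty _ e'0; exists x.
  exists (e / (2 * M)) => //= y ye; apply: le_lt_trans (nM _) _.
  rewrite -ltr_pdivlMl //.
  have -> : u (x - y) = (s d + u x) - (s d + u y).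
    by rewrite linearB opprD addrACA subrr add0r.
  apply: le_lt_trans (alg_normB _ _ _) _.
  have eE : e / (2 * M) = M^-1 * e / 2 by rewrite invfM mulrA mulrC mulrA.
  by rewrite [ltRHS]splitr -eE; exact: ltrD.
suff : s d + u l = 0 by move=> /(congr1 f); rewrite linearD fu addr0 sf linear0.
apply: (@alg_norm0_eq0 _ _ p); apply/eqP; rewrite eq_le alg_norm_ge0 andbT.
apply/ler_addgt0Pr => e e0; rewrite add0r.
have e2 : 0 < e / 2 by rewrite divr_gt0.
have FsD : F (near0 (e / 2)) by exists (e / 2).
have [y [ly ye]] := filter_ex (filterI (Fl (e / 2 / N) (divr_gt0 e2 N0)) FsD).
have -> : s d + u l = u (l - y) + (s d + u y).
  by rewrite linearB addrCA subrK.
apply: le_trans (alg_normD _ _ _) _.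
rewrite [leRHS]splitr lerD ?(ltW ye) //; apply: le_trans (pN _) _.
by rewrite mulrC -ler_pdivlMr // ltW.
Qed.

End CompleteNorm.

(** Uniqueness on [I] makes the pullback of [p] along [u] equivalent to the complete norm [n], so
    the kernel of [f] is closed; uniqueness on [D] then compares [m] with the quotient norm. *)
Lemma factor_projection_le (R : realType) (I C D : nuAlgType R[i])
    (n : algNorm I) (m : algNorm D) (p : algNorm C)
    (u : {linear I -> C}) (r : {linear C -> I})
    (f : {linear C -> D}) (s : {linear D -> C}) :
  complete_norm n -> amul_morph u -> amul_morph f ->
  cancel u r -> (forall i, f (u i) = 0) -> cancel s f ->
  (forall c, s (f c) + u (r c) = c) ->
  (forall q q' : algNorm I, norm_equiv q q') ->
  (forall q q' : algNorm D, norm_equiv q q') ->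
  exists2 M, 0 < M & forall c, m (f c) <= M * p c.
Proof.
move=> n_complete uM fM ru fu sf decomp I_unique D_unique.
have /norm_equivP[[M M0 nM] [N N0 pN]] :=
  I_unique n (comp_norm uM (can_inj ru) p).
have f_surj d : exists c, f c = d by exists (s d).
have [q qp] := quotient_norm fM f_surj
  (complete_ker_closed n_complete fu sf decomp M0 nM N0 pN).
have /norm_equivP[[L L0 mL] _] := D_unique m q.
exists L => // c; apply: le_trans (mL _) _.
by rewrite ler_pM2l.
Qed.

(** * The splitting of [dsprod B] into copies of [A] and [B] *)

Section DirectSumProduct.
Context {K : numFieldType} {A : nuAlgType K} (B : nuSubalgClosed A).

Definition ds_fst (x : dsprod B) : A := x.1 + val x.2.
Definition ds_snd (x : dsprod B) : subalg B := x.2.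
Definition ds_inl (a : A) : dsprod B := (a, 0).
(** The sign puts this copy of [B] in the kernel of [ds_fst] and makes its products with the copy of
    [A] vanish. *)
Definition ds_inr (b : subalg B) : dsprod B := (- val b, b).

Fact ds_fst_linear : linear ds_fst.
Proof. by move=> k [a b] [c d]; rewrite /ds_fst /= scalerDr addrACA. Qed.
HB.instance Definition _ :=
  GRing.isLinear.Build K (dsprod B) A *:%R ds_fst ds_fst_linear.

Fact ds_snd_linear : linear ds_snd.
Proof. by move=> k [a b] [c d]. Qed.
HB.instance Definition _ :=
  GRing.isLinear.Build K (dsprod B) (subalg B) *:%R ds_snd ds_snd_linear.

Fact ds_inl_linear : linear ds_inl.
Proof. by move=> k a c; congr (_, _); rewrite /= scaler0 addr0. Qed.
HB.instance Definition _ :=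
  GRing.isLinear.Build K A (dsprod B) *:%R ds_inl ds_inl_linear.

Fact ds_inr_linear : linear ds_inr.
Proof. by move=> k b d; congr (_, _); rewrite /= opprD scalerN. Qed.
HB.instance Definition _ :=
  GRing.isLinear.Build K (subalg B) (dsprod B) *:%R ds_inr ds_inr_linear.

Lemma ds_fstM : amul_morph ds_fst.
Proof.
move=> [a b] [c d]; rewrite /ds_fst /= amulDl !amulDr.
by rewrite addrA.
Qed.

Lemma ds_sndM : amul_morph ds_snd.
Proof. by move=> [a b] [c d]. Qed.

Lemma ds_inlM : amul_morph ds_inl.
Proof.
move=> a c; congr (_, _); last by rewrite amul0l.
by rewrite /= amul0l amul0r !addr0.
Qed.

Lemma ds_inrM : amul_morph ds_inr.
Proof.
move=> b d; congr (_, _); rewrite /=.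
by rewrite !(amulNl, amulNr) opprK subrr add0r.
Qed.

Lemma ds_inlK : cancel ds_inl ds_fst.
Proof. by move=> a; rewrite /ds_fst /= addr0. Qed.

Lemma ds_inrK : cancel ds_inr ds_snd.
Proof. by []. Qed.

Lemma ds_fst_inr b : ds_fst (ds_inr b) = 0.
Proof. by rewrite /ds_fst /= addNr. Qed.

Lemma ds_snd_inl a : ds_snd (ds_inl a) = 0.
Proof. by []. Qed.

Lemma ds_decomp x : ds_inl (ds_fst x) + ds_inr (ds_snd x) = x.
Proof. by case: x => a b; congr (_, _); rewrite /= ?addrK ?add0r. Qed.

Lemma ds_eq0 x : ds_fst x = 0 -> ds_snd x = 0 -> x = 0.
Proof. by rewrite -{3}(ds_decomp x) => -> ->; rewrite !linear0 addr0. Qed.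

Definition ds_norm (p : algNorm A) (q : algNorm (subalg B)) :
    algNorm (dsprod B) :=
  sum_norm ds_fstM ds_sndM ds_eq0 p q.

(** On the copy of [A] the summand coming from [q] vanishes. *)
Lemma ds_norm_equivl (p p' : algNorm A) (q : algNorm (subalg B)) :
  norm_equiv (ds_norm p q) (ds_norm p' q) -> norm_equiv p p'.
Proof.
move=> /norm_equivP[[M M0 pM] [N N0 pN]]; apply/norm_equivP.
split; [exists M|exists N] => // a; [have := pM|have := pN];
  by move=> /(_ (ds_inl a)) /=; rewrite ds_inlK alg_norm0 !addr0.
Qed.

Lemma ds_norm_equivr (p : algNorm A) (q q' : algNorm (subalg B)) :
  norm_equiv (ds_norm p q) (ds_norm p q') -> norm_equiv q q'.
Proof.
move=> /norm_equivP[[M M0 pM] [N N0 pN]]; apply/norm_equivP.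
split; [exists M|exists N] => // b; [have := pM|have := pN];
  by move=> /(_ (ds_inr b)) /=; rewrite ds_fst_inr alg_norm0 !add0r.
Qed.

(** Uniqueness bounds [t] on the two copies by multiples of [p] and [q]; the triangle inequality
    along [ds_decomp] combines the bounds. *)
Lemma ds_norm_ge (p : algNorm A) (q : algNorm (subalg B))
    (t : algNorm (dsprod B)) :
  (forall p p' : algNorm A, norm_equiv p p') ->
  (forall q q' : algNorm (subalg B), norm_equiv q q') ->
  exists2 M, 0 < M & forall x, t x <= M * ds_norm p q x.
Proof.
move=> A_unique B_unique.
have /norm_equivP[[M M0 pM] _] :=
  A_unique (comp_norm ds_inlM (can_inj ds_inlK) t) p.
have /norm_equivP[[N N0 qN] _] :=
  B_unique (comp_norm ds_inrM (can_inj ds_inrK) t) q.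
exists (M + N) => [|x]; first exact: addr_gt0.
rewrite -{1}(ds_decomp x); apply: le_trans (alg_normD _ _ _) _.
rewrite mulrDr lerD //; [apply: le_trans (pM _) _|apply: le_trans (qN _) _].
all: by rewrite ler_wpM2r ?alg_norm_ge0 // ?lerDl ?lerDr ltW.
Qed.

End DirectSumProduct.

(** * The given norm of [A] and its restriction to [B] *)

Section BanachNorm.
Local Obligation Tactic := idtac.
Context {K : numFieldType} (A : banachAlgType K).

Program Definition banach_norm : algNorm A :=
  @AlgNorm K A (fun x => `|x|) _ _ _ _.
Next Obligation. exact: ler_normD. Qed.
Next Obligation. exact: normrZ. Qed.
Next Obligation. by move=> x; exact: normr0_eq0. Qed.
Next Obligation. exact: ler_amul_norm. Qed.

Lemma banach_norm_complete : complete_norm banach_norm.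
Proof. by apply: (@complete_norm_closed _ _ _ _ idfun). Qed.

Context (B : nuSubalgClosed A).

Fact val_subalg_morph : amul_morph (val : subalg B -> A).
Proof. by []. Qed.

Definition subalg_norm : algNorm (subalg B) :=
  comp_norm val_subalg_morph val_inj banach_norm.

Lemma subalg_norm_complete : closed [set` B] -> complete_norm subalg_norm.
Proof.
move=> B_closed.
apply: (@complete_norm_closed _ _ _ _ (val : {linear subalg B -> A})) => //.
rewrite (_ : range _ = [set` B]) //; apply/seteqP; split=> [_ [x _ <-]|x xB].
  exact: valP.
by exists (exist _ x xB).
Qed.

End BanachNorm.

Theorem theorem2p5 (R : realType) (A : banachAlgType R[i])
    (B : nuSubalgClosed A) (B_closed : closed [set` B]) :
  (singleton (norm_classes A) /\ singleton (norm_classes (subalg B))) <->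
  singleton (norm_classes (dsprod B)).
Proof.
pose nA := banach_norm A; pose nB := subalg_norm B.
rewrite !singleton_norm_classesP; split=> [[[_ A_unique] [_ B_unique]]|].
  split; first by split; exact: ds_norm nA nB.
  suff all_equiv t : norm_equiv t (ds_norm nA nB).
    by move=> t t'; rewrite /norm_equiv all_equiv -(all_equiv t').
  apply/norm_equivP; split; first exact: ds_norm_ge.
  have [M M0 fst_le] : exists2 M, 0 < M & forall x, nA (ds_fst x) <= M * t x.
    (* The kernel of [ds_fst] is the copy of [B], whose norm [nB] is complete because [B] is
       closed. *)
    exact: (factor_projection_le (n := nB) nA t (r := @ds_snd _ _ B)
      (s := @ds_inl _ _ B) (subalg_norm_complete B_closed) (@ds_inrM _ _ B)
      (@ds_fstM _ _ B) (@ds_inrK _ _ B) (@ds_fst_inr _ _ B) (@ds_inlK _ _ B)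
      (@ds_decomp _ _ B) B_unique A_unique).
  have decompC (x : dsprod B) : ds_inr (ds_snd x) + ds_inl B (ds_fst x) = x.
    by rewrite addrC ds_decomp.
  have [N N0 snd_le] : exists2 N, 0 < N & forall x, nB (ds_snd x) <= N * t x.
    (* The roles are exchanged: the kernel of [ds_snd] is the copy of the Banach algebra [A]. *)
    exact: (factor_projection_le (n := nA) nB t (r := @ds_fst _ _ B)
      (s := @ds_inr _ _ B) (@banach_norm_complete _ A) (@ds_inlM _ _ B)
      (@ds_sndM _ _ B) (@ds_inlK _ _ B) (@ds_snd_inl _ _ B) (@ds_inrK _ _ B)
      decompC A_unique B_unique).
  exists (M + N) => [|x]; first exact: addr_gt0.
  by rewrite mulrDl; exact: lerD (fst_le x) (snd_le x).
(* Existence of norms on the factors is witnessed by [nA] and [nB]. *)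
move=> [_ D_unique]; split; split; try by split.
- by move=> p p'; apply: (@ds_norm_equivl _ _ B _ _ nB); exact: D_unique.
- by move=> q q'; apply: (@ds_norm_equivr _ _ B nA); exact: D_unique.
Qed.
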